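(* Let $\mu,\nu$ be Borel probability measures on $\mathbb{R}$ with bounded support such that $\operatorname{supp}(\mu)\subseteq[0,1]$, $\mu$ is atomless and $\nu$ is embedded in $\mu$. Put $\varphi(f)=f\circ\check F_\mu^{-1}$. Then for every $\gamma\in[0,\pi/2]^2$ and every $*\in\{s,w\}$ we have $$\Delta_{\nu\circ F_\mu^{-1},\Lambda}\circ\varphi=\varphi\circ\Delta_{\nu,\mu}\quad\text{and}\quad \varphi\big(\mathcal{D}^*_\gamma(\Delta_{\nu,\mu})\big)=\mathcal{D}^*_\gamma\big(\Delta_{\nu\circ F_\mu^{-1},\Lambda}\big).$$
   Context: Embedded: $\nu$ is embedded in $\mu$ if $\operatorname{supp}(\nu)\subseteq\operatorname{supp}(\mu)$ and no atom of $\nu$ is a boundary point of a connected component of $\mathbb{R}\setminus\operatorname{supp}(\mu)$. $F_\mu$ is the distribution function of $\mu$; its pseudo-inverse is $\check F_\mu^{-1}(x)=\inf\{y\in[0,1]:F_\mu(y)\ge x\}$, $x\in[0,1]$. $\nu\circ F_\mu^{-1}$ is the push-forward of $\nu$ under $F_\mu$. $\Lambda$ is Lebesgue measure restricted to $[0,1]$ (so $F_\Lambda(x)=x$ on $[0,1]$). The definitions below are applied both to the pair $(\nu,\mu)$ and to the pair $(\nu\circ F_\mu^{-1},\Lambda)$. $C_{\nu,\mu}$ is the Banach space, with the sup norm, of continuous $f:[0,1]\to\mathbb{R}$ such that on each connected component $J$ of $[0,1]\setminus\operatorname{supp}(\nu)$ there are $a_J,b_J\in\mathbb{R}$ with $f=a_JF_\mu+b_J$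 on $J$. Set $\mathcal{S}^w(\nu,\mu)=L^2(\nu)$ (weak case) and $\mathcal{S}^s(\nu,\mu)=C_{\nu,\mu}$ (strong case). The map $\varphi$ is regarded as a map $\mathcal{S}^*(\nu,\mu)\to\mathcal{S}^*(\nu\circ F_\mu^{-1},\Lambda)$. A function $f\in C([0,1])$ lies in $\mathcal{D}^*(\Delta_{\nu,\mu})$ ($*\in\{s,w\}$) if there are $a,b\in\mathbb{R}$ and $g\in\mathcal{S}^*(\nu,\mu)$ with $$f(x)=a+bF_\mu(x)+\int_{[0,x]}(F_\mu(x)-F_\mu(y))g(y)\,d\nu(y)\quad\text{for all }x\in[0,1].$$ Here $a=f(0)$, and $b$ and the element $g$ of $\mathcal{S}^*(\nu,\mu)$ are uniquely determined by $f$; one sets $\Delta_{\nu,\mu}f:=g\in\mathcal{S}^*(\nu,\mu)$, $\nabla_\mu f(0):=b$ (which equals $\lim_{x\searrow \inf\operatorname{supp}(\mu)}(f(x)-f(0))/F_\mu(x)$) and $\nabla_\mu f(1):=b+\int g\,d\nu$. For $\gamma=(\alpha,\beta)\in[0,\pi/2]^2$, $\mathcal{D}^*_\gamma(\Delta_{\nu,\mu})$ is the set of $f\in\mathcal{D}^*(\Delta_{\nu,\mu})$ with $$f(0)\cos\alpha-\nabla_\mu f(0)\sin\alpha=0,\qquad f(1)\cos\beta+\nabla_\mu f(1)\sin\beta=0.$$ The operator identity means that $\Delta_{\nu\circ F_\mu^{-1},\Lambda}(f\circ\check F_\mu^{-1})=(\Delta_{\nu,\mu}f)\circ\check F_\mu^{-1}$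 as elements of $\mathcal{S}^*(\nu\circ F_\mu^{-1},\Lambda)$ for every $f\in\mathcal{D}^*_\gamma(\Delta_{\nu,\mu})$, that is, in $C_{\nu\circ F_\mu^{-1},\Lambda}$ if $*=s$ and in $L^2(\nu\circ F_\mu^{-1})$ if $*=w$.
   Formalization: In the strong case g is not uniquely determined by f (e.g. μ=Λ, ν=δ_{1/2}), so Δ is taken as a multivalued operator (all admissible g), and the operator identity is proved as equality of the sets of values. *)

(* Defs.v *)
From HB Require Import structures.
From mathcomp Require Import all_boot all_order all_algebra.
From mathcomp Require Import all_classical all_reals all_analysis.
From mathcomp Require Import measurable_realfun.

Set Implicit Arguments.
Unset Strict Implicit.
Unset Printing Implicit Defensive.
Import Order.TTheory GRing.Theory Num.Theory.
Import numFieldNormedType.Exports.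

Local Open Scope classical_set_scope.
Local Open Scope ring_scope.

Section measures_on_the_line.
Context {R : realType}.
Implicit Types mu nu : probability (measurableTypeR R) R.

Definition supp mu : set R :=
  [set x | forall U : set R, open U -> U x -> (0 < mu U)%E].

Definition atom mu (x : R) : Prop := (0 < mu [set x])%E.

Definition atomless mu : Prop := forall x : R, ~ atom mu x.

Definition boundary (A : set R) : set R := closure A `\` interior A.

Definition embedded nu mu : Prop :=
  supp nu `<=` supp mu /\
  forall x z : R, atom nu x -> (~` supp mu) z ->
    ~ boundary (connected_component (~` supp mu) z) x.

Definition dF mu (x : R) : R := fine (mu `]-oo, x]%classic).

Lemma measurable_dF mu :
  measurable_fun [set: measurableTypeR R] (dF mu : _ -> measurableTypeR R).
Proof.
apply: nondecreasing_measurable => //= r s rs.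
by rewrite fine_le ?fin_num_measure// le_measure ?inE//; exact: subitvPr.
Qed.

Definition dF_mfun mu : {mfun measurableTypeR R >-> measurableTypeR R} :=
  HB.pack (dF mu : measurableTypeR R -> measurableTypeR R)
    (isMeasurableFun.Build _ _ _ _ _ (measurable_dF mu)).

(* For x outside [0, 1] the value is irrelevant (it is 0). *)
Definition dF_inv mu (x : R) : R :=
  inf [set y : R | y \in `[0, 1] /\ x <= dF mu y].

Definition push nu mu : probability (measurableTypeR R) R :=
  distribution nu (dF_mfun mu).

Definition lebesgue01 : set (measurableTypeR R) -> \bar R :=
  mrestr (@lebesgue_measure R) (measurable_itv `[0, 1]).

HB.instance Definition _ := Measure.on lebesgue01.

Lemma lebesgue01_setT : lebesgue01 [set: _] = 1%E.
Proof.
rewrite /lebesgue01 /mrestr setTI lebesgue_measure_itv/= lte_fin ltr01.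
by rewrite oppr0 adde0.
Qed.

HB.instance Definition _ :=
  Measure_isProbability.Build _ _ _ lebesgue01 lebesgue01_setT.

Definition Lambda : probability (measurableTypeR R) R := lebesgue01.

End measures_on_the_line.

Inductive mode := strong | weak.

(* Functions on [0, 1] are represented by functions on R: all conditions below
   only involve values on [0, 1], except that an element of L^2(nu) is
   represented by a Borel function on R.  This makes no difference since the
   measures considered are concentrated on [0, 1]. *)
Section krein_feller.
Context {R : realType}.
Implicit Types (mu nu : probability (measurableTypeR R) R) (f g h : R -> R).

Definition C01 : set (R -> R) :=
  [set f : R -> R | {within `[0, 1], continuous f}].

Definition Cspace nu mu : set (R -> R) :=
  [set f : R -> R | C01 f /\
    forall z : R, (`[0, 1] `\` supp nu) z ->
      exists a b : R, forall x : R,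
        connected_component (`[0, 1] `\` supp nu) z x -> f x = a * dF mu x + b].

Definition Sspace (m : mode) nu mu : set (R -> R) :=
  match m with
  | strong => Cspace nu mu
  | weak => [set g : R -> R | (g : measurableTypeR R -> R) \in Lfun nu 2%:E]
  end.

(* equality of elements of [Sspace m nu mu], mu being irrelevant *)
Definition Seq (m : mode) nu g h : Prop :=
  match m with
  | strong => {in `[0, 1], g =1 h}
  | weak => {ae nu, forall x, g x = h x}
  end.

Definition Delta_repr (m : mode) nu mu f (a b : R) g : Prop :=
  [/\ C01 f, Sspace m nu mu g &
    forall x : R, x \in `[0, 1] ->
      f x = a + b * dF mu x
            + \int[nu]_(y in `[0, x]) ((dF mu x - dF mu y) * g y)].

(* The operator Delta_{nu,mu} as a relation: [Delta m nu mu f] is the set of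
   all representatives g of Delta f, and it is nonempty iff f is in the domain.
   For nu embedded in the atomless measure mu: if m = weak, it is a single class
   modulo nu-a.e. equality; if m = strong, the equation determines g on supp nu
   and between its points, but when supp nu does not reach an extremity of
   supp mu, the slope of g with respect to dF mu on the corresponding outer
   component of [0, 1] \ supp nu is free (e.g. nu a Dirac mass at 1/2 and mu
   uniform), so that Delta f may have several values. *)
Definition Delta (m : mode) nu mu f : set (R -> R) :=
  [set g : R -> R | exists a b : R, Delta_repr m nu mu f a b g].

(* b is nabla f(0) and b + \int g dnu is nabla f(1); neither depends on the
   choice of (b, g) when nu is embedded in the atomless measure mu. *)
Definition Dom (m : mode) nu mu (alpha beta : R) : set (R -> R) :=
  [set f : R -> R | exists a b g,
    [/\ Delta_repr m nu mu f a b g,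
        f 0 * cos alpha - b * sin alpha = 0 &
        f 1 * cos beta + (b + \int[nu]_(y in `[0, 1]) g y) * sin beta = 0]].

Definition phi mu f : R -> R := f \o dF_inv mu.

(* the image under phi, as a set of functions on [0, 1] *)
Definition phi_image mu (D : set (R -> R)) : set (R -> R) :=
  [set h : R -> R | exists2 f, D f & {in `[0, 1], h =1 phi mu f}].

End krein_feller.

(* Main.v *)
(* Since [mu] has no atoms, [F = dF mu] is continuous and [F (G x) = x] on [0, 1]
   for [G = dF_inv mu].  A function [f] in the domain, and a density [g] in the
   strong case, only depends on [F x], so [f = phi mu f \o F], and continuity
   descends along the quotient map [F] of the compact interval [0, 1].  In the
   weak case embeddedness gives [g = phi mu g \o F] only [nu]-almost everywhere:
   [G \o F] moves only countably many points of the support of [nu], and none of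
   them is an atom.  The change of variables [y := F x] then identifies the
   integral equations for [(nu, mu)] and [(push nu mu, Lambda)] with the same
   constants [a] and [b]. *)
Require Import Defs.
From mathcomp Require Import all_boot all_order all_algebra.
From mathcomp Require Import all_classical all_reals all_analysis.
From mathcomp Require Import measurable_realfun lra.
Import Order.TTheory GRing.Theory Num.Theory.
Import numFieldNormedType.Exports.
Local Open Scope classical_set_scope.
Local Open Scope ring_scope.
Set Implicit Arguments.
Unset Strict Implicit.
Unset Printing Implicit Defensive.

(** * Supports and distribution functions of probability measures on the line *)

Section support_and_distribution_function.
Context {R : realType}.
Implicit Types P mu nu : probability (measurableTypeR R) R.

Lemma supp_null P (U : set R) : open U -> P U = 0%E -> U `<=` ~` supp P.
Proof. by move=> oU PU0 x Ux /(_ U oU Ux); rewrite PU0 ltxx. Qed.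

(** Second countability: a point off the support has a null neighbourhood, hence lies in a null
    interval with rational endpoints, and there are only countably many of these. *)
Lemma negligible_setC_supp P : P.-negligible (~` supp P).
Proof.
pose I (n : nat) : set R :=
  if unpickle n is Some (p, q) then `]ratr p, ratr (q : rat)[%classic else set0.
pose V n : set (measurableTypeR R) := if P (I n) == 0%E then I n else set0.
apply: (negligibleS _ (negligible_bigcup (F := V) _)).
- move=> x /= /existsNP[U /not_implyP[oU /not_implyP[Ux /negP]]].
  rewrite -leNgt => PU0.
  have /nbhs_ballP[e /= e0 xeU] : nbhs x U by exact: open_nbhs_nbhs.
  have [p] : exists p : rat, ratr p \in `]x - e, x[.
    by apply: rat_in_itvoo; lra.
  rewrite in_itv/= => /andP[ep px].
  have [q] : exists q : rat, ratr q \in `]x, x + e[.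
    by apply: rat_in_itvoo; lra.
  rewrite in_itv/= => /andP[xq qe].
  have Ipq : I (pickle (p, q)) = `]ratr p, ratr q[%classic by rewrite /I pickleK.
  exists (pickle (p, q)) => //; rewrite /V ifT Ipq; first by rewrite /= in_itv/= px.
  rewrite eq_le measure_ge0 andbT (le_trans _ PU0)// le_measure ?inE//.
    exact: open_measurable.
  move=> y /=; rewrite in_itv/= => /andP[py yq]; apply: xeU.
  by rewrite /ball/= ltr_distlC; lra.
- move=> n; rewrite /V; case: ifPn => [/eqP PI0|_]; last exact: negligible_set0.
  apply/negligibleP => //; rewrite /I.
  by case: unpickle => [[p q]|].
Qed.

Lemma dF_nondecreasing P : {homo dF P : x y / x <= y}.
Proof.
by move=> r s rs; rewrite fine_le ?fin_num_measure// le_measure ?inE//;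
  exact: subitvPr.
Qed.

Lemma probability_itv_oc P (u v : R) : u <= v -> P `]u, v]%classic = (dF P v - dF P u)%:E.
Proof.
move=> uv; rewrite EFinB /dF !fineK ?fin_num_measure//.
have -> : `]-oo, v]%classic = `]-oo, u] `|` `]u, v]%classic :> set R.
  by rewrite -itv_bndbnd_setU.
rewrite measureU//.
  rewrite -[LHS](@addeK _ (P `]-oo, u]%classic)) ?fin_num_measure//.
  by congr (_ - _)%E; exact: addeC.
by rewrite -subset0 => x [] /=; rewrite !in_itv/= => xu /andP[]; rewrite ltNge xu.
Qed.

(** The intervals [E n] shrink to the null set [[set x]], so their masses tend to 0; by monotonicity
    such a mass bounds the variation of [dF P] near [x]. *)
Lemma dF_continuous P : atomless P -> continuous (dF P).
Proof.
move=> P0 x.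
pose E n : set (measurableTypeR R) := `]x - n.+1%:R^-1, x + n.+1%:R^-1]%classic.
have mE n : measurable (E n) by exact: measurable_itv.
have PE : P (E n) @[n --> \oo] --> 0%E.
  have -> : 0%E = P (\bigcap_n E n).
    rewrite (_ : \bigcap_n E n = [set x]).
      by apply/esym/eqP; rewrite eq_le measure_ge0 andbT leNgt; exact/negP/P0.
    apply/seteqP; split => y /=; last first.
      move=> -> n _; rewrite /E/= in_itv/= ltrBlDr ltrDl lerDl.
      by rewrite invr_ge0 invr_gt0 ltr0n /= ler0n.
    move=> Ey; apply/eqP; rewrite -subr_eq0 -normr_le0; apply/ler_addgt0Pl => e e0.
    (* At this index the radius is at most [e]. *)
    rewrite addr0; have := Ey (Num.truncn e^-1) Logic.I.
    rewrite /E/= in_itv/=; set t := _.+1%:R^-1 => /andP[y1 y2].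
    apply: (@le_trans _ _ t); first by rewrite ler_distlC; apply/andP; split; lra.
    rewrite /t invf_ple ?posrE ?ltr0n//.
    exact/ltW/truncnS_gt.
  apply: nonincreasing_cvg_mu => //.
  - by rewrite -ge0_fin_numE// fin_num_measure.
  - exact: bigcap_measurable.
  - move=> n m nm; apply/subsetPset; apply: subset_itv; rewrite bnd_simp.
      by rewrite lerD2l lerN2 lef_pV2 ?posrE ?ltr0n// ler_nat.
    by rewrite lerD2l lef_pV2 ?posrE ?ltr0n// ler_nat.
apply/cvgrPdist_lt => e e0.
have : \forall n \near \oo, (P (E n) < e%:E)%E.
  have := PE [set y : \bar R | (y < e%:E)%E]; apply.
  by apply: open_nbhs_nbhs; split => //; exact: open_ereal_lt_ereal.
case=> n _ /(_ n (leqnn n)) /=; rewrite /E.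
set d := n.+1%:R^-1 => PEe.
have d0 : 0 < d by rewrite invr_gt0 ltr0n.
rewrite probability_itv_oc ?lte_fin in PEe; last by lra.
near=> y.
have : `|x - y| < d by near: y; exact: cvgr_dist_lt.
rewrite ltr_distl => /andP[y1 y2].
have := @dF_nondecreasing P (x - d) x; have := @dF_nondecreasing P x (x + d).
have := @dF_nondecreasing P (x - d) y; have := @dF_nondecreasing P y (x + d).
by rewrite ltr_distl; lra.
Unshelve. all: by end_near. Qed.

End support_and_distribution_function.

(** * The distribution function of [mu] and its pseudo-inverse *)

Section quantile.
Context {R : realType} (mu : probability (measurableTypeR R) R).
Local Notation F := (dF mu).
Local Notation G := (dF_inv mu).

Lemma dF_ge0 x : 0 <= F x.
Proof. exact: fine_ge0. Qed.

Lemma dF_le1 x : F x <= 1.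
Proof. by rewrite -[leRHS]/(fine 1%E) fine_le ?fin_num_measure// probability_le1. Qed.

Lemma dF_in01 x : F x \in `[0, 1].
Proof. by rewrite in_itv/= dF_ge0 dF_le1. Qed.

Lemma dF_flat_supp u v : u <= v -> F u = F v -> `]u, v[ `<=` ~` supp mu.
Proof.
move=> uv Fuv; apply: supp_null => //.
apply/eqP; rewrite eq_le measure_ge0 andbT.
have <- : mu `]u, v]%classic = 0%E by rewrite probability_itv_oc// Fuv subrr.
by rewrite le_measure ?inE//; exact: subset_itvW.
Qed.

Context (mu_atomless : atomless mu) (supp_mu : supp mu `<=` `[0, 1]).

Lemma dF0 : F 0 = 0.
Proof.
rewrite /dF -[RHS]/(fine 0%E); congr fine; apply: measure_negligible => //.
(* The half-line splits into []-oo, 0[], which misses the support, and the point 0, which is not an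
   atom. *)
rewrite -(setUitv1 true)//; apply: negligibleU; last first.
  apply/negligibleP => //; apply/eqP; rewrite eq_le measure_ge0 andbT leNgt.
  exact/negP/mu_atomless.
apply: negligibleS (negligible_setC_supp mu) => x /=.
by rewrite in_itv/= => x0 /supp_mu/=; rewrite in_itv/= leNgt x0.
Qed.

Lemma dF1 : F 1 = 1.
Proof.
rewrite /dF -[RHS]/(fine 1%E); congr fine.
rewrite -[X in mu X]setCK probability_setC; last exact: measurableC.
rewrite measure_negligible ?sube0//; first exact: measurableC.
apply: negligibleS (negligible_setC_supp mu) => x /=.
by rewrite in_itv/= => x1 /supp_mu/=; rewrite in_itv/= => /andP[_ ?]; apply: x1.
Qed.

Let S x : set R := [set y | y \in `[0, 1] /\ x <= F y].

Let has_inf_S x : x <= 1 -> has_inf (S x).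
Proof.
move=> x1; split; first by exists 1; split; rewrite ?dF1// in_itv/= ler01 lexx.
by exists 0 => y []; rewrite in_itv/= => /andP[].
Qed.

Lemma dF_inv_le x y : y \in `[0, 1] -> x <= F y -> G x <= y.
Proof.
move=> y01 xy; apply: ge_inf; last by split.
by exists 0 => z []; rewrite in_itv/= => /andP[].
Qed.

(** For [x < 0] all of [0, 1] competes in the infimum; for [x > 1] nothing does, and the infimum of
    the empty set is 0 by convention. *)
Lemma dF_inv_out x : x \notin `[0, 1] -> G x = 0.
Proof.
rewrite in_itv/= negb_and -!ltNge => /orP[x0|x1].
  apply/eqP; rewrite eq_le dF_inv_le ?in_itv/= ?lexx ?ler01//; last first.
    by rewrite dF0 ltW.
  apply: lb_le_inf; first by have [] := has_inf_S (le_trans (ltW x0) ler01).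
  by move=> y []; rewrite in_itv/= => /andP[].
rewrite /dF_inv (_ : [set _ | _] = set0) ?inf0//.
by rewrite -subset0 => y [_]; rewrite leNgt (le_lt_trans (dF_le1 y) x1).
Qed.

Lemma dF_inv_in01 x : G x \in `[0, 1].
Proof.
have [x01|/dF_inv_out ->] := boolP (x \in `[0, 1]); last by rewrite in_itv/= lexx ler01.
have x1 : x <= 1 by move: x01; rewrite in_itv/= => /andP[].
rewrite in_itv/= dF_inv_le ?dF1 ?in_itv/= ?lexx ?ler01// andbT.
apply: lb_le_inf; first by have [] := has_inf_S x1.
by move=> y []; rewrite in_itv/= => /andP[].
Qed.

Lemma dF_inv_homo : {in `[0, 1] &, {homo G : x y / x <= y}}.
Proof.
move=> x y x01; rewrite in_itv/= => /andP[y0 y1] xy; apply: lb_le_inf.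
  by have [] := has_inf_S y1.
by move=> z [z01 yz]; apply: dF_inv_le => //; exact: le_trans yz.
Qed.

Lemma dF_IVT u v t : u <= v -> F u <= t <= F v -> exists2 c, c \in `[u, v] & F c = t.
Proof.
move=> uv /andP[ut tv]; apply: IVT => //.
  by apply: continuous_subspaceT => x; exact: dF_continuous.
by rewrite ge_min le_max ut tv orbT.
Qed.

Lemma dF_invK : {in `[0, 1], cancel G F}.
Proof.
move=> x x01; have := x01; rewrite in_itv/= => /andP[x0 x1].
have [||c c01 Fc] := @dF_IVT 0 1 x => //; first by rewrite dF0 dF1 x0 x1.
have Gc : G x <= c by rewrite dF_inv_le// Fc.
have FG : F (G x) <= x by rewrite -[leRHS]Fc dF_nondecreasing.
apply/eqP; rewrite eq_le FG /= leNgt; apply/negP => FGx.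
(* Since [F d < x], every competitor in the infimum defining [G x] is at least [d], so [d <= G x];
   but [F d > F (G x)]. *)
have [||d dG Fd] := @dF_IVT (G x) c ((F (G x) + x) / 2) => //; first by rewrite Fc; lra.
suff : d <= G x by move=> /(dF_nondecreasing mu); rewrite Fd; lra.
apply: lb_le_inf; first by have [] := has_inf_S x1.
move=> y [_ xy]; rewrite leNgt; apply/negP => /ltW/(dF_nondecreasing mu).
by rewrite Fd; lra.
Qed.

Lemma measurable_dF_inv :
  measurable_fun [set: measurableTypeR R] (G : _ -> measurableTypeR R).
Proof.
(* Clamping the argument to [0, 1] makes [G] monotone on the whole line; [G] is the restriction of
   this function to [0, 1], extended by 0. *)
pose H x := G (Num.min (Num.max x 0) 1).
have -> : G = H \_ `[0, 1].
  apply/funext => x; rewrite patchE; case: ifPn => [|x01].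
    rewrite inE/= in_itv/= => /andP[x0 x1].
    by rewrite /H max_l// min_l.
  by rewrite dF_inv_out//; apply: contra x01 => x01; rewrite inE.
apply: (measurable_restrictT H _).1 => //; apply: measurable_funTS.
apply: nondecreasing_measurable => // x y xy; rewrite /H; apply: dF_inv_homo.
- by rewrite in_itv/= le_min ge_min le_max !lexx ler01 !orbT.
- by rewrite in_itv/= le_min ge_min le_max !lexx ler01 !orbT.
- by apply: le_min2; rewrite ?lexx//; apply: le_max2; rewrite ?lexx.
Qed.

Lemma dF_inv_dF_le x : x \in `[0, 1] -> G (F x) <= x.
Proof. by move=> x01; exact: dF_inv_le. Qed.

Lemma supp_in_itv nu : embedded nu mu -> {ae nu, forall x, x \in `[0, 1]}.
Proof.
move=> [nu_mu _]; apply: negligibleS (negligible_setC_supp nu) => x /= x01.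
by move=> /nu_mu/supp_mu.
Qed.

(* Where G \o F is not the identity, F is constant on an interval to the left of
   the point; such points of the support of nu are right endpoints of gaps of
   the support of mu, hence countably many, and none of them is an atom. *)
Lemma dF_invK_ae nu : embedded nu mu -> {ae nu, forall x, G (F x) = x}.
Proof.
move=> [nu_mu nu_atom].
pose I n : set R := if unpickle n is Some q
  then [set x | [/\ supp nu x, G (F x) < ratr (q : rat) & ratr q < x]] else set0.
(* [F] takes the same value at [G (F x)] and at [x], hence at every point in between. *)
have gap x y : supp mu x -> G (F x) < y -> y < x -> F y = F x.
  move=> /supp_mu/= x01 Gy yx; apply/eqP; rewrite eq_le.
  rewrite dF_nondecreasing ?(ltW yx)//= -[leLHS]dF_invK ?dF_in01//.
  by rewrite dF_nondecreasing// ltW.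
have negl : nu.-negligible (~` supp nu `|` \bigcup_n I n).
  apply: negligibleU; first exact: negligible_setC_supp.
  apply: negligible_bigcup => n; rewrite /I.
  case: unpickle => [q|]; last exact: negligible_set0.
  case: (pselect (exists x, supp nu x /\ G (F x) < ratr q /\ ratr q < x)); last first.
    move=> qn; apply: negligibleS (negligible_set0 nu) => x [xnu Gq qx].
    by apply: qn; exists x.
  move=> [x [xnu [Gq qx]]].
  have muqx : `]ratr q, x[ `<=` ~` supp mu.
    by apply: dF_flat_supp; [exact: ltW|exact: gap (nu_mu _ xnu) _ _].
  (* Each [I n] has at most one point: of two such points, the smaller would lie in the flat
     interval to the left of the larger, off the support of [mu]. *)
  apply: (@negligibleS _ _ _ nu [set x]).
    move=> y [ynu Gqy qy] /=; apply/eqP; rewrite eq_le !leNgt; apply/andP.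
    split; apply/negP.
      move=> xy; have : `]ratr q, y[ `<=` ~` supp mu.
        by apply: dF_flat_supp; [exact: ltW|exact: gap (nu_mu _ ynu) _ _].
      by move=> /(_ x); apply; [rewrite /= in_itv/= qx|exact: nu_mu].
    by move=> yx; apply: (muqx y); [rewrite /= in_itv/= qy|exact: nu_mu].
  apply/negligibleP => //; apply/eqP; rewrite eq_le measure_ge0 andbT leNgt.
  apply/negP => /nu_atom.
  pose z := (ratr q + x) / 2.
  have zqx : `]ratr q, x[%classic z by rewrite /= in_itv/= /z; lra.
  (* [x] is a boundary point of the component of [z]: this component contains []q, x[], whereas [x]
     is in the support of [mu]. *)
  move=> /(_ z (muqx _ zqx)); apply; split; last first.
    by move=> /interior_subset/connected_component_sub; apply; exact: nu_mu.
  have qxC : `]ratr q, x[ `<=` connected_component (~` supp mu) z.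
    apply: connected_component_max => //.
    exact/connected_intervalP/interval_is_interval.
  apply: (closure_subset qxC) => B /nbhs_ballP[e /= e0 xeB].
  (* The maximum keeps the point inside []q, x[] and within [e] of [x]. *)
  exists (Num.max z (x - e / 2)); split.
    rewrite /= in_itv/= lt_max gt_max; move: zqx; rewrite /= in_itv/= => /andP[-> ->].
    by rewrite ltrBlDr ltrDl divr_gt0.
  apply: xeB; rewrite /ball/= ltr_distlC lt_max gt_max.
  move: zqx; rewrite /= in_itv/= => /andP[_ zx].
  by apply/andP; split; [apply/orP; right; lra|apply/andP; split; lra].
apply: negligibleS negl => x /= /eqP GFx.
case: (pselect (supp nu x)) => [xnu|]; [right|by left].
have GF : G (F x) < x by rewrite lt_neqAle GFx dF_inv_dF_le//; exact/supp_mu/nu_mu.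
have [q] := rat_in_itvoo GF; rewrite in_itv/= => /andP[Gq qx].
by exists (pickle q); [exact: Logic.I|rewrite /I pickleK].
Qed.

End quantile.

(** * Continuity: compact quotients and functions on the unit interval *)

Lemma within_continuous_quotient (T U V : topologicalType) (A : set T)
    (p : T -> U) (f : T -> V) (h : U -> V) :
  hausdorff_space U -> compact A ->
  {within A, continuous p} -> {within A, continuous f} ->
  {in A, f =1 h \o p} -> {within p @` A, continuous h}.
Proof.
move=> hU cA cp cf fhp; apply/continuous_closedP => C cC; apply/closed_subspaceP.
have /continuous_closedP/(_ C cC)/closed_subspaceP[W cW WA] := cf.
exists (p @` (W `&` A)).
  apply: compact_closed => //; apply: continuous_compact.
    exact: continuous_subspaceW cp.
  by rewrite setIC; exact: compact_closedI.
rewrite WA; apply/seteqP; split => y /= [].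
- move=> [x [Cfx Ax] <-]; split; last by exists x.
  by have /= fx := fhp x (mem_set Ax); rewrite /from_subspace -fx.
- move=> Chy [x Ax pxy]; split; last by exists x.
  exists x => //; split => //.
  by have /= fx := fhp x (mem_set Ax); rewrite /from_subspace fx pxy.
Qed.

Section unit_interval_functions.
Context {R : realType}.
Implicit Types (f g h k p : R -> R) (mu nu : probability (measurableTypeR R) R).

Lemma C01_comp k p : continuous p -> (forall x, p x \in `[0, 1]) ->
  C01 k -> C01 (k \o p).
Proof.
move=> cp p01 /subspace_continuousP ck; apply/subspace_continuousP => x _.
apply: (cvg_comp p k _ (ck _ (p01 x))) => B.
move=> Bp.
have Np : nbhs x (p @^-1` [set y | `[0, 1]%classic y -> B y]) by exact: (cp x).
by apply: filterS Np => y /= By _; exact: By (p01 y).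
Qed.

(** Uniqueness of the one-sided limits extends the equality to the endpoints. *)
Lemma eq_C01_itvcc f g (u v : R) : C01 f -> C01 g -> 0 <= u -> u < v -> v <= 1 ->
  {in `]u, v[, f =1 g} -> {in `[u, v], f =1 g}.
Proof.
move=> cf cg u0 uv v1 fg.
have sub : `[u, v]%classic `<=` `[0, 1]%classic by apply: subset_itv; rewrite bnd_simp.
have /(continuous_within_itvP _ uv)[_ fu fv] := continuous_subspaceW sub cf.
have /(continuous_within_itvP _ uv)[_ gu gv] := continuous_subspaceW sub cg.
have fgu : f u = g u.
  apply: (cvg_unique _ fu) => //; apply: cvg_trans gu; apply: near_eq_cvg.
  near=> x; rewrite fg// in_itv/=; apply/andP; split; near: x.
    exact: nbhs_right_gt.
  exact: nbhs_right_lt.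
have fgv : f v = g v.
  apply: (cvg_unique _ fv) => //; apply: cvg_trans gv; apply: near_eq_cvg.
  near=> x; rewrite fg// in_itv/=; apply/andP; split; near: x.
    exact: nbhs_left_gt.
  exact: nbhs_left_lt.
move=> x; rewrite in_itv/= => /andP[ux xv].
have [<-//|nux] := eqVneq u x; have [->//|nxv] := eqVneq x v.
by apply: fg; rewrite in_itv/= !lt_neqAle nux nxv ux xv.
Unshelve. all: by end_near. Qed.

Lemma dF_Lambda : {in `[0, 1], dF (@Lambda R) =1 id}.
Proof.
move=> x; rewrite in_itv/= => /andP[x0 x1].
rewrite /dF /= /lebesgue01 /mrestr.
rewrite (_ : _ `&` _ = `[0, x]%classic); last first.
  apply/seteqP; split => y /=; rewrite !in_itv/=; first by move=> [-> /andP[->]].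
  by move=> /andP[-> yx]; rewrite yx (le_trans yx).
rewrite lebesgue_measure_itv/= lte_fin; case: ifPn => [_|].
  by rewrite oppr0 adde0.
by rewrite -leNgt => x0'; apply/eqP; rewrite eq_le x0 x0'.
Qed.

Lemma C01_affine_dF mu (a b : R) : atomless mu -> C01 (fun x => a * dF mu x + b).
Proof.
move=> mu0; apply: continuous_subspaceT => x; apply: cvgD; last exact: cvg_cst.
by apply: cvgM; [exact: cvg_cst|exact: dF_continuous].
Qed.

Lemma eq_C01 f g : {in `[0, 1], f =1 g} -> C01 f -> C01 g.
Proof.
move=> fg; rewrite /C01/= => cf; apply: subspace_eq_continuous cf => x.
by rewrite inE => /fg.
Qed.

End unit_interval_functions.

(** * Transfer of the strong spaces in both directions *)

Section transfer_of_piecewise_affine_functions.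
Context {R : realType} (mu nu : probability (measurableTypeR R) R).
Context (mu_atomless : atomless mu) (supp_mu : supp mu `<=` `[0, 1]).
Context (supp_nu : supp nu `<=` supp mu).
Local Notation F := (dF mu).
Local Notation G := (dF_inv mu).
Implicit Types (f g h k : R -> R).

Lemma C01_pull k : C01 k -> C01 (k \o F).
Proof. by apply: C01_comp; [exact: dF_continuous|exact: dF_in01]. Qed.

Lemma dF_image01 : F @` `[0, 1] = `[0, 1]%classic.
Proof.
apply/seteqP; split => [_ [x _ <-]|x x01]; first exact: dF_in01.
by exists (G x); [exact: dF_inv_in01|exact: dF_invK].
Qed.

Lemma C01_phi f : C01 f -> {in `[0, 1], f =1 f \o G \o F} -> C01 (phi mu f).
Proof.
move=> cf fGF; rewrite /C01/= -dF_image01.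
apply: (within_continuous_quotient (f := f)) => //.
- exact: segment_compact.
- by apply: continuous_subspaceT => x; exact: dF_continuous.
- by move=> x; rewrite inE => /fGF.
Qed.

(** Where [F] is flat there is no support of [mu], hence none of [nu], so [g] is affine in [F] on
    []u, v[], and by continuity on [[u, v]]. *)
Lemma Cspace_flat g u v : Cspace nu mu g -> 0 <= u -> u <= v -> v <= 1 ->
  F u = F v -> g u = g v.
Proof.
move=> [cg gaff] u0; rewrite le_eqVlt => /predU1P[->//|uv] v1 Fuv.
have uvC : `]u, v[ `<=` `[0, 1] `\` supp nu.
  move=> x xuv; split; last by move=> /supp_nu; exact: dF_flat_supp (ltW uv) Fuv _ xuv.
  move: xuv; rewrite /= !in_itv/= => /andP[ux xv].
  by rewrite !ltW// ?(le_lt_trans u0)// (lt_le_trans xv).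
have zuv : `]u, v[%classic ((u + v) / 2) by rewrite /= in_itv/=; lra.
have [a [b gab]] := gaff _ (uvC _ zuv).
have guv : {in `[u, v], g =1 (fun x => a * F x + b)}.
  apply: eq_C01_itvcc => //; first exact: C01_affine_dF.
  move=> x xuv; apply: gab; apply: (connected_component_max zuv uvC) => //.
  exact/connected_intervalP/interval_is_interval.
by rewrite !guv ?Fuv// in_itv/= lexx ltW.
Qed.

Lemma Cspace_dF_invK g : Cspace nu mu g -> {in `[0, 1], g =1 g \o G \o F}.
Proof.
move=> gC x x01; apply/esym; apply: (Cspace_flat gC).
- by have := dF_inv_in01 mu_atomless supp_mu (F x); rewrite in_itv/= => /andP[].
- exact: dF_inv_dF_le.
- by move: x01; rewrite in_itv/= => /andP[].
- by rewrite dF_invK// dF_in01.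
Qed.

Lemma supp_push x : supp nu x -> supp (push nu mu) (F x).
Proof.
move=> nux U oU UFx; apply: (nux (F @^-1` U)) => //.
by apply: open_comp => // y _; exact: dF_continuous.
Qed.

Lemma Cspace_phi g : Cspace nu mu g -> Cspace (push nu mu) Lambda (phi mu g).
Proof.
move=> gC; have := gC => -[cg gaff]; split.
  by apply: C01_phi => //; exact: Cspace_dF_invK.
move=> z z0.
have GC x : (`[0, 1] `\` supp (push nu mu)) x -> (`[0, 1] `\` supp nu) (G x).
  move=> [x01 nux]; split; first exact: dF_inv_in01.
  by move=> /supp_push; rewrite dF_invK.
have [a [b gab]] := gaff _ (GC _ z0); exists a, b => x xz.
have /connected_component_sub x0 := xz.
rewrite dF_Lambda; last by case: x0.
rewrite -{2}(@dF_invK _ mu mu_atomless supp_mu x); last by case: x0.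
apply: gab.
set J := connected_component (`[0, 1] `\` supp (push nu mu)) z in xz.
have itvJ : is_interval J by apply/connected_intervalP; exact: component_connected.
have Jz : J z by exact: connected_component_refl.
(* In [0, 1] the preimage of [J] under the monotone [F] is an interval avoiding the support of [nu];
   it contains [G z] and [G x], so the coefficients found at [G z] are valid at [G x]. *)
apply: (@connected_component_max _ _ (`[0, 1] `&` F @^-1` J)).
- by split; [exact: dF_inv_in01|rewrite /= dF_invK//; case: z0].
- move=> y [y01 /connected_component_sub[_ Jy]]; split => //.
  by move=> /supp_push.
- apply/connected_intervalP => u v /= [u01 Ju] [v01 Jv] y /andP[uy yv].
  split.
    move: u01 v01; rewrite !in_itv/= => /andP[u0 _] /andP[_ v1].
    by rewrite (le_trans u0)// (le_trans yv).
  by apply: (itvJ _ _ Ju Jv); rewrite !dF_nondecreasing.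
- by split; [exact: dF_inv_in01|rewrite /= dF_invK//; case: x0].
Qed.

(** By monotonicity the preimage of []F u, F v[] under [F] lies in [[u, v]], so it is [nu]-null. *)
Lemma supp_push_disjoint u v : `[u, v] `&` supp nu = set0 ->
  `]F u, F v[ `<=` ~` supp (push nu mu).
Proof.
move=> uv0; apply: supp_null => //.
suff : nu (F @^-1` `]F u, F v[) = 0%E by [].
apply: measure_negligible.
  by rewrite -[X in measurable X]setTI; exact: measurable_dF.
apply: negligibleS (negligible_setC_supp nu) => x /=.
rewrite in_itv/= => /andP[Fux Fxv] xnu.
suff : (`[u, v] `&` supp nu) x by rewrite uv0.
split => //=; rewrite in_itv/= !leNgt; apply/andP; split; apply/negP.
  by move=> /ltW/(dF_nondecreasing mu); rewrite leNgt Fux.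
by move=> /ltW/(dF_nondecreasing mu); rewrite leNgt Fxv.
Qed.

Lemma Cspace_pull k : Cspace (push nu mu) Lambda k -> Cspace nu mu (k \o F).
Proof.
move=> [ck kaff]; split; first exact: C01_pull.
move=> z z0.
set J := connected_component (`[0, 1] `\` supp nu) z.
have itvJ : is_interval J by apply/connected_intervalP; exact: component_connected.
(* If [F] is constant on [J], slope 0 suffices; otherwise [F] maps [J] onto a nondegenerate
   interval, where the coefficients can be read off. *)
have [Fcst|] := pselect (forall x, J x -> F x = F z).
  by exists 0, (k (F z)) => x Jx; rewrite /= Fcst// mul0r add0r.
move=> /existsNP[w /not_implyP[Jw /eqP Fwz]].
have Jz : J z by exact: connected_component_refl.
(* F maps the interior of J into the complement of the support of the push-forward,
   so k is affine there, and on the closure by continuity. *)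
pose t := (F w + F z) / 2.
have JF u v : J u -> J v -> `]F u, F v[ `<=` `[0, 1] `\` supp (push nu mu).
  move=> Ju Jv x xuv; split.
    have := dF_in01 mu u; have := dF_in01 mu v.
    by move: xuv; rewrite /= !in_itv/=; lra.
  apply: supp_push_disjoint xuv; rewrite -subset0 => y [].
  rewrite /= in_itv/= => uyv ynu.
  by have /connected_component_sub[_] := itvJ _ _ Ju Jv _ uyv.
have [p [q [Jp Jq tpq]]] : exists p q, [/\ J p, J q & `]F p, F q[%classic t].
  move: Fwz; rewrite neq_lt => /orP[Fwz|Fwz]; [exists w, z|exists z, w];
    by split => //; rewrite /= in_itv/= /t; lra.
have [a [b kab]] := kaff t (JF _ _ Jp Jq _ tpq).
exists a, b => x Jx.
(* Both points stay in [J], []F u, F v[] still contains [t], and [[F u, F v]] contains [F x],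
   possibly as an endpoint. *)
pose u := Num.min x p; pose v := Num.max x q.
have Ju : J u by rewrite /u; case: leP.
have Jv : J v by rewrite /v; case: leP.
have Fup : F u <= F p by rewrite dF_nondecreasing// /u ge_min lexx orbT.
have Fqv : F q <= F v by rewrite dF_nondecreasing// /v le_max lexx orbT.
have Fux : F u <= F x by rewrite dF_nondecreasing// /u ge_min lexx.
have Fxv : F x <= F v by rewrite dF_nondecreasing// /v le_max lexx.
have tuv : `]F u, F v[%classic t.
  by move: tpq; rewrite /= !in_itv/= => /andP[]; lra.
have kuv : {in `[F u, F v], k =1 (fun y => a * y + b)}.
  apply: eq_C01_itvcc => //.
  - apply: continuous_subspaceT => y; apply: cvgD; last exact: cvg_cst.
    by apply: cvgM; [exact: cvg_cst|exact: cvg_id].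
  - exact: dF_ge0.
  - by move: tuv; rewrite /= in_itv/= => /andP[]; exact: lt_trans.
  - exact: dF_le1.
  - move=> y yuv; have y01 := (JF _ _ Ju Jv _ yuv).1.
    rewrite kab ?dF_Lambda//.
    apply: (connected_component_max tuv (JF _ _ Ju Jv)) => //.
    exact/connected_intervalP/interval_is_interval.
by rewrite /= kuv// in_itv/= Fux Fxv.
Qed.

End transfer_of_piecewise_affine_functions.

(** * Change of variables for integrals and for square-integrable functions *)

Section change_of_variables.
Context {R : realType} (mu nu : probability (measurableTypeR R) R).
Local Notation F := (dF mu).
Local Notation I01 := (`[0%R, 1%R]%classic : set (measurableTypeR R)).
Implicit Types (D E : set (measurableTypeR R)).
Implicit Types (g k w : measurableTypeR R -> measurableTypeR R).

Lemma ae_eq_Rintegral D E g k : measurable D -> measurable E ->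
  measurable_fun D g -> measurable_fun E k ->
  {ae nu, forall x, (g \_ D) x = (k \_ E) x} ->
  \int[nu]_(x in D) g x = \int[nu]_(x in E) k x.
Proof.
move=> mD mE mg mk gk; rewrite Rintegral_mkcond [RHS]Rintegral_mkcond; congr fine.
apply: ae_eq_integral => //.
- by apply/measurable_EFinP; exact: (measurable_restrictT g mD).1.
- by apply/measurable_EFinP; exact: (measurable_restrictT k mE).1.
- by apply: filterS gk => x /= ->.
Qed.

(** The formula for nonnegative functions is applied to the positive and negative parts. *)
Lemma Rintegral_push D k : measurable D -> measurable_fun D k ->
  \int[push nu mu]_(x in D) k x = \int[nu]_(x in F @^-1` D) k (F x).
Proof.
move=> mD /measurable_EFinP mk; congr fine; rewrite integralE [RHS]integralE.
congr (_ - _)%E; rewrite ge0_integral_pushforward//.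
- by rewrite !unlock.
- exact: measurable_funepos.
- by rewrite !unlock.
- exact: measurable_funeneg.
Qed.

(** [D] and the preimage of [E] under [F] may differ; the last hypothesis makes the weight [w \o F]
    vanish where they do on [0, 1]. *)
Lemma Rintegral_transfer D E g k w : measurable D -> measurable E ->
  D `<=` I01 -> E `<=` I01 ->
  measurable_fun I01 g -> measurable_fun I01 k -> measurable_fun setT w ->
  {ae nu, forall x, x \in `[0, 1]} -> {ae nu, forall x, g x = k (F x)} ->
  {in `[0, 1], forall x, ((w \o F) \_ D) x = (w \_ E) (F x)} ->
  \int[nu]_(x in D) (w (F x) * g x) = \int[push nu mu]_(x in E) (w x * k x).
Proof.
move=> mD mE D01 E01 mg mk mw nu01 gk wDE.
have mF := measurable_dF mu.
have mwk : measurable_fun E (fun x => w x * k x).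
  by apply: measurable_funM; [exact: measurable_funTS|exact: measurable_funS mk].
rewrite Rintegral_push//; apply: ae_eq_Rintegral => //.
- by rewrite -[X in measurable X]setTI; exact: mF.
- apply: measurable_funM; last exact: measurable_funS mg.
  by apply: measurable_funTS; exact: measurableT_comp.
- apply: (@measurable_comp _ _ _ _ _ _ E (fun x => w x * k x) (F @^-1` E) F) => //.
    by move=> _ [x Ex <-].
  exact: measurable_funTS.
- apply: (@filterS2 _ _ (ae_filter_ringOfSetsType nu) _ _ _ _ nu01 gk) => x x01 gkx.
  have := wDE x x01; rewrite !patchE /= gkx.
  rewrite (_ : (x \in F @^-1` E) = (F x \in E)) //.
  by do 2 case: ifPn => _ //; [move=> ->|move=> <-]; rewrite mul0r.
Qed.

Lemma measurable_normr_poweR k (r : R) : measurable_fun setT k ->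
  measurable_fun setT (fun x => `|(k x)%:E| `^ r)%E.
Proof.
move=> mk; apply: (measurableT_comp (measurable_poweR r)).
by apply: measurableT_comp => //; exact/measurable_EFinP.
Qed.

Lemma Lfun_push k : measurable_fun setT k ->
  k \o F \in Lfun nu 2%:E -> k \in Lfun (push nu mu) 2%:E.
Proof.
move=> mk /andP[_ kF2]; apply/andP; split; first by rewrite inE.
move: kF2; rewrite !inE /= /finite_norm unlock /=.
rewrite ge0_integral_pushforward//.
exact: measurable_normr_poweR.
Qed.

Lemma ae_eq_Lfun g k : measurable_fun setT k -> {ae nu, forall x, g x = k x} ->
  g \in Lfun nu 2%:E -> k \in Lfun nu 2%:E.
Proof.
move=> mk gk /andP[]; rewrite !inE /= => mg g2; apply/andP; split; first by rewrite inE.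
move: g2; rewrite !inE /= /finite_norm unlock /=.
rewrite (@ae_eq_integral _ _ _ _ _ (fun x => (`|(k x)%:E| `^ 2)%E))//.
- exact: measurable_normr_poweR.
- exact: measurable_normr_poweR.
- by apply: filterS gk => x /= ->.
Qed.

End change_of_variables.

(** * Transfer of the integral equation, the operator and its domain *)

Section transfer_of_the_operator.
Context {R : realType} (mu nu : probability (measurableTypeR R) R).
Context (mu_atomless : atomless mu) (supp_mu : supp mu `<=` `[0, 1]).
Context (nu_embedded : embedded nu mu) (m : mode).
Local Notation F := (dF mu).
Local Notation G := (dF_inv mu).
Local Notation nuF := (push nu mu).
Implicit Types (f g h k : R -> R) (a b : R).

Lemma measurable_Sspace (mu' nu' : probability (measurableTypeR R) R) g :
  Sspace m nu' mu' g ->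
  measurable_fun (`[0%R, 1%R]%classic : set (measurableTypeR R))
    (g : measurableTypeR R -> measurableTypeR R).
Proof.
case: m => /= [[cg _]|].
  exact: subspace_continuous_measurable_fun.
by case/andP; rewrite inE/= => mg _; exact: measurable_funTS.
Qed.

(** In the weak case [phi mu g \o F] equals [g] almost everywhere, so it is square-integrable for
    [nu], and the norm passes to the push-forward. *)
Lemma Sspace_phi g : Sspace m nu mu g -> Sspace m nuF Lambda (phi mu g).
Proof.
case: m => /= gS; first by apply: Cspace_phi => //; case: nu_embedded.
have mg : measurable_fun [set: measurableTypeR R] (g : _ -> measurableTypeR R).
  by case/andP: gS; rewrite inE.
have mgG := measurableT_comp mg (measurable_dF_inv mu_atomless supp_mu).
apply: Lfun_push => //; apply: ae_eq_Lfun gS.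
  by apply: measurableT_comp => //; exact: measurable_dF.
apply: negligibleS (dF_invK_ae mu_atomless supp_mu nu_embedded) => x /=.
by apply: contra_not; rewrite /phi/= => ->.
Qed.

Lemma Sspace_pull k : Sspace m nuF Lambda k -> Sspace m nu mu (k \o F).
Proof.
case: m => /= kS; first by apply: Cspace_pull => //; case: nu_embedded.
case/andP: kS; rewrite !inE /= => mk k2; apply/andP; split.
  by rewrite inE/=; apply: measurableT_comp => //; exact: measurable_dF.
move: k2; rewrite inE/= /finite_norm unlock/= ge0_integral_pushforward//.
exact: measurable_normr_poweR.
Qed.

Lemma phi_dF_ae g : {ae nu, forall x, g x = (phi mu g (F x))}.
Proof.
apply: negligibleS (dF_invK_ae mu_atomless supp_mu nu_embedded) => x /=.
by apply: contra_not; rewrite /phi/= => ->.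
Qed.

(** Enlarging the domain of integration from [[0, u]] to [[0, v]] only adds points [y] of []u, v]],
    where the kernel [F v - F y] vanishes. *)
Lemma Delta_repr_flat f g a b u v : Delta_repr m nu mu f a b g ->
  0 <= u -> u <= v -> v <= 1 -> F u = F v -> f u = f v.
Proof.
move=> [_ _ fE] u0 uv v1 Fuv.
rewrite !fE ?in_itv/= ?u0 ?v1 ?(le_trans u0)// ?(le_trans uv)//.
rewrite Fuv; congr (_ + _); rewrite Rintegral_mkcond [RHS]Rintegral_mkcond.
apply: eq_Rintegral => y _; rewrite !patchE !mem_setE !in_itv/=.
have [yu|uy] := leP y u; first by rewrite (le_trans yu uv).
rewrite andbF; have [yv|_] := leP y v; last by rewrite andbF.
case: ifPn => // _; apply/esym/eqP; rewrite mulf_eq0 subr_eq0 eq_le.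
by rewrite -{1}Fuv !dF_nondecreasing// ltW.
Qed.

Lemma Delta_repr_dF_invK f g a b : Delta_repr m nu mu f a b g ->
  {in `[0, 1], f =1 phi mu f \o F}.
Proof.
move=> fg x x01; apply/esym; apply: (Delta_repr_flat fg).
- by have := dF_inv_in01 mu_atomless supp_mu (F x); rewrite in_itv/= => /andP[].
- exact: dF_inv_dF_le.
- by move: x01; rewrite in_itv/= => /andP[].
- by rewrite dF_invK// dF_in01.
Qed.

Section corresponding_densities.
Context (g k : R -> R) (gS : Sspace m nu mu g) (kS : Sspace m nuF Lambda k).
Context (gk : {ae nu, forall x, g x = k (F x)}).

Lemma Rintegral_density :
  \int[nu]_(x in `[0, 1]) g x = \int[nuF]_(x in `[0, 1]) k x.
Proof.
transitivity (\int[nu]_(x in `[0, 1]) (cst 1 (F x) * g x)).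
  by apply: eq_Rintegral => x _; rewrite mul1r.
rewrite (@Rintegral_transfer _ _ _ _ `[0, 1]%classic _ k)//.
- by apply: eq_Rintegral => x _; rewrite mul1r.
- exact: measurable_Sspace gS.
- exact: measurable_Sspace kS.
- exact: (supp_in_itv supp_mu nu_embedded).
- by move=> x x01; rewrite !patchE !mem_setE x01 dF_in01.
Qed.

(** The weight is [F x - y]. The interval [[0, x]] and the preimage of [[0, F x]] differ in [0, 1]
    only at points [y > x] with [F y = F x], where the weight at [F y] is 0. *)
Lemma Rintegral_kernel (x : R) : x \in `[0, 1] ->
  \int[nu]_(y in `[0, x]) ((F x - F y) * g y) =
  \int[nuF]_(y in `[0, F x]) ((dF Lambda (F x) - dF Lambda y) * k y).
Proof.
rewrite in_itv/= => /andP[x0 x1].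
have sub (t : R) : t <= 1 -> `[0, t]%classic `<=` `[0, 1]%classic.
  by move=> t1; apply: subset_itv; rewrite bnd_simp.
transitivity (\int[nuF]_(y in `[0, F x]) ((F x - y) * k y)); last first.
  apply: eq_Rintegral => y; rewrite inE => /(sub _ (dF_le1 mu x)) y01.
  by rewrite !dF_Lambda ?dF_in01.
rewrite (@Rintegral_transfer _ _ _ _ `[0, F x]%classic _ k (fun y => F x - y))//.
- exact: sub.
- exact/sub/dF_le1.
- exact: measurable_Sspace gS.
- exact: measurable_Sspace kS.
- exact: measurable_funB.
- exact: (supp_in_itv supp_mu nu_embedded).
- move=> y; rewrite in_itv/= => /andP[y0 y1].
  rewrite !patchE !mem_setE !in_itv/= y0 dF_ge0/=.
  have [yx|xy] := leP y x; first by rewrite dF_nondecreasing.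
  case: ifPn => // Fyx; apply/esym/eqP; rewrite subr_eq0 eq_le Fyx andbT.
  by rewrite dF_nondecreasing// ltW.
Qed.

(** One direction evaluates the equation at [G x], using [F (G x) = x], the other at [F x]. The
    relation [g = k \o F] almost everywhere covers both [k = phi mu g] and [g = k \o F]. *)
Lemma Delta_repr_transfer f h a b : C01 f -> C01 h -> {in `[0, 1], f =1 h \o F} ->
  Delta_repr m nu mu f a b g <-> Delta_repr m nuF Lambda h a b k.
Proof.
move=> cf ch fh; split=> -[_ _ E]; split=> // x x01.
  rewrite -[in LHS](dF_invK mu_atomless supp_mu x01).
  have Gx := dF_inv_in01 mu_atomless supp_mu x.
  have /= <- := fh (G x) Gx.
  by rewrite E// Rintegral_kernel// dF_invK// dF_Lambda.
by rewrite fh//= E ?dF_in01// Rintegral_kernel// dF_Lambda ?dF_in01.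
Qed.

End corresponding_densities.

Lemma Delta_repr_phi f g a b : Delta_repr m nu mu f a b g ->
  Delta_repr m nuF Lambda (phi mu f) a b (phi mu g).
Proof.
move=> fg; have fGF := Delta_repr_dF_invK fg; have := fg => -[cf gS _].
apply: (Delta_repr_transfer gS (Sspace_phi gS) (phi_dF_ae g) _ _ cf _ fGF).1 => //.
exact: C01_phi.
Qed.

Lemma Delta_repr_pull f h k a b : C01 f -> {in `[0, 1], f =1 h \o F} ->
  Delta_repr m nuF Lambda h a b k -> Delta_repr m nu mu f a b (k \o F).
Proof.
move=> cf fh hk; have := hk => -[ch kS _].
apply: (Delta_repr_transfer (Sspace_pull kS) kS _ _ _ cf ch fh).2 => //.
by apply: nearW.
Qed.

Lemma phi_pull k : {in `[0, 1], k =1 phi mu (k \o F)}.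
Proof. by move=> x x01; rewrite /phi/= dF_invK. Qed.

(** The two functions agree on [0, 1], and the push-forward has no mass elsewhere because [F] takes
    its values in [0, 1]. *)
Lemma Seq_phi_pull k : Seq m nuF k (phi mu (k \o F)).
Proof.
case: m => /=; first exact: phi_pull.
have nuF01 : nuF.-negligible (~` `[0, 1]).
  apply/negligibleP; first exact: measurableC.
  rewrite -[LHS]/(nu (F @^-1` ~` `[0, 1]%classic)) (_ : _ @^-1` _ = set0) ?measure0//.
  by rewrite -subset0 => x; apply; exact: dF_in01.
by apply: negligibleS nuF01 => x /=; apply: contra_not => /phi_pull.
Qed.

Lemma eq_Delta_repr (mu' nu' : probability (measurableTypeR R) R) f h g a b :
  {in `[0, 1], f =1 h} ->
  Delta_repr m nu' mu' f a b g -> Delta_repr m nu' mu' h a b g.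
Proof.
move=> fh [cf gS fE]; split => //; first exact: eq_C01 cf.
by move=> x x01; rewrite -fh// fE.
Qed.

(** The constants [a], [b] and the total integral of the density are preserved, and [F 0 = 0],
    [F 1 = 1] match the endpoint values, so the boundary conditions coincide. *)
Lemma phi_image_Dom alpha beta :
  phi_image mu (Dom m nu mu alpha beta) = Dom m nuF Lambda alpha beta.
Proof.
have O01 : (0 : R) \in `[0, 1] by rewrite in_itv/= lexx ler01.
have I01 : (1 : R) \in `[0, 1] by rewrite in_itv/= lexx ler01.
have F0 := dF0 mu_atomless supp_mu; have F1 := dF1 supp_mu.
apply/seteqP; split => h /=.
  move=> [f [a [b [g [fg f0 f1]]]] hf]; exists a, b, (phi mu g).
  have fGF := Delta_repr_dF_invK fg; have := fg => -[_ gS _]; split.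
  - by apply: eq_Delta_repr (Delta_repr_phi fg) => x x01; rewrite hf.
  - by rewrite hf//; have := fGF 0 O01; rewrite /= F0 => <-.
  - rewrite hf//; have := fGF 1 I01; rewrite /= F1 => <-.
    by rewrite -(Rintegral_density gS (Sspace_phi gS) (phi_dF_ae g)).
move=> [a [b [k [hk h0 h1]]]]; exists (h \o F); last exact: phi_pull.
have := hk => -[ch kS _]; exists a, b, (k \o F); split.
- by apply: Delta_repr_pull hk => //; exact: C01_pull.
- by rewrite /= F0.
- by rewrite /= F1 (Rintegral_density (Sspace_pull kS) kS)//; apply: nearW.
Qed.

End transfer_of_the_operator.

(** As [Delta] is a relation, the operator identity becomes two inclusions between sets of values,
    the second one up to [Seq]. *)
Theorem theorem9 (R : realType) (mu nu : probability (measurableTypeR R) R)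
    (bounded_mu : bounded_set (supp mu)) (bounded_nu : bounded_set (supp nu))
    (supp_mu : supp mu `<=` `[0, 1]) (mu_atomless : atomless mu)
    (nu_embedded : embedded nu mu)
    (alpha beta : R) (alpha_itv : alpha \in `[0, pi / 2])
    (beta_itv : beta \in `[0, pi / 2]) (m : mode) :
  (forall f : R -> R, Dom m nu mu alpha beta f ->
     (forall g : R -> R, Delta m nu mu f g ->
        Delta m (push nu mu) Lambda (phi mu f) (phi mu g)) /\
     (forall k : R -> R, Delta m (push nu mu) Lambda (phi mu f) k ->
        exists2 g : R -> R, Delta m nu mu f g &
          Seq m (push nu mu) k (phi mu g))) /\
  phi_image mu (Dom m nu mu alpha beta) = Dom m (push nu mu) Lambda alpha beta.
Proof.
split; last exact: phi_image_Dom.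
move=> f [a [b [g [fg _ _]]]]; split => [g' [a' [b' fg']]|k [a' [b' fk]]].
  by exists a', b'; exact: Delta_repr_phi.
(* The pull-back of [k] is a density for [f] because [f] equals [phi mu f \o dF mu] on [0, 1]. *)
exists (k \o dF mu); last exact: Seq_phi_pull.
exists a', b'; apply: Delta_repr_pull fk => //; first by case: fg.
exact: Delta_repr_dF_invK fg.
Qed.
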